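(* A polynomial $f(z_0,z_1,z_2,z_3)\in\mathbb{C}[z_0,z_1,z_2,z_3]$ is the characteristic polynomial of a finite-dimensional complex representation of $\mathfrak{sl}(2,\mathbb{C})$ if and only if there exist an integer $N\ge 0$ and non-negative integers $d_0,d_1,\dots,d_N$ such that $$f(z_0,z_1,z_2,z_3)=z_0^{d_0}\prod_{n=1}^{N}\left(z_0^2-n^2(z_1^2+z_2z_3)\right)^{d_n}$$ and $d_n\geq d_{n+2}$ for every integer $n\ge 0$, where $d_n:=0$ for $n>N$.
   Context: $\mathfrak{sl}(2,\mathbb{C})$ is the Lie algebra of traceless $2\times 2$ complex matrices with basis $h=\begin{pmatrix}1&0\\0&-1\end{pmatrix}$, $e_1=\begin{pmatrix}0&1\\0&0\end{pmatrix}$, $e_2=\begin{pmatrix}0&0\\1&0\end{pmatrix}$. For a finite-dimensional complex representation $\phi$ of $\mathfrak{sl}(2,\mathbb{C})$, its characteristic polynomial is $$f_{\phi}(z_0,z_1,z_2,z_3)=\det\left(z_0 I+z_1\phi(h)+z_2\phi(e_1)+z_3\phi(e_2)\right)\in\mathbb{C}[z_0,z_1,z_2,z_3].$$ The zero representation is allowed; its characteristic polynomial is $1$. *)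

(* Defs.v *)
From mathcomp Require Import all_boot all_order all_algebra.
From mathcomp Require Import reals complex mpoly.

Set Implicit Arguments.
Unset Strict Implicit.
Unset Printing Implicit Defensive.

Import GRing.Theory.
Import passmx.

Local Open Scope ring_scope.

Definition sl2 (F : fieldType) : {vspace 'M[F]_2} :=
  lker (linfun (mxtrace : 'M[F]_2 -> F^o)).

Lemma mem_sl2 (F : fieldType) (A : 'M[F]_2) : (A \in sl2 F) = (\tr A == 0).
Proof. by rewrite memv_ker lfunE. Qed.

Lemma sl2_bracket_subproof (F : fieldType) (A B : 'M[F]_2) :
  A *m B - B *m A \in sl2 F.
Proof. by rewrite mem_sl2 linearB /= mxtrace_mulC subrr. Qed.

Definition sl2_bracket (F : fieldType) (x y : subvs_of (sl2 F)) :
    subvs_of (sl2 F) :=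
  Subvs (sl2_bracket_subproof (vsval x) (vsval y)).

Lemma sl2_h_subproof (F : fieldType) :
  (delta_mx 0 0 - delta_mx 1 1 : 'M[F]_2) \in sl2 F.
Proof.
rewrite mem_sl2 linearB /= /mxtrace !big_ord_recl !big_ord0 !mxE /=.
by rewrite !addr0 add0r subrr.
Qed.

Lemma sl2_e1_subproof (F : fieldType) : (delta_mx 0 1 : 'M[F]_2) \in sl2 F.
Proof. by rewrite mem_sl2 /mxtrace !big_ord_recl !big_ord0 !mxE /= !addr0. Qed.

Lemma sl2_e2_subproof (F : fieldType) : (delta_mx 1 0 : 'M[F]_2) \in sl2 F.
Proof. by rewrite mem_sl2 /mxtrace !big_ord_recl !big_ord0 !mxE /= !addr0. Qed.

Definition sl2_h (F : fieldType) : subvs_of (sl2 F) := Subvs (sl2_h_subproof F).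
Definition sl2_e1 (F : fieldType) : subvs_of (sl2 F) :=
  Subvs (sl2_e1_subproof F).
Definition sl2_e2 (F : fieldType) : subvs_of (sl2 F) :=
  Subvs (sl2_e2_subproof F).

Definition sl2_representation (F : fieldType) (V : vectType F)
    (phi : 'Hom(subvs_of (sl2 F), 'End(V))) : Prop :=
  forall x y : subvs_of (sl2 F),
    phi (sl2_bracket x y) = (phi x \o phi y)%VF - (phi y \o phi x)%VF.

Definition zvar (F : fieldType) (k : nat) : {mpoly F[4]} := 'X_(inord k).

(* The determinant is computed from coordinates in the basis [vbasis {:V}].
   [mxof] uses row vectors, hence gives the transpose of the usual matrix of an
   endomorphism; this does not affect the determinant of the pencil. *)
Definition mpoly_mxof (F : fieldType) (V : vectType F) (u : 'End(V)) :
    'M[{mpoly F[4]}]_(\dim {:V}) :=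
  map_mx (@mpolyC 4 F) (mxof (vbasis {:V}) (vbasis {:V}) u).

Definition sl2_charpoly (F : fieldType) (V : vectType F)
    (phi : 'Hom(subvs_of (sl2 F), 'End(V))) : {mpoly F[4]} :=
  \det ((zvar F 0)%:M
        + zvar F 1 *: mpoly_mxof (phi (sl2_h F))
        + zvar F 2 *: mpoly_mxof (phi (sl2_e1 F))
        + zvar F 3 *: mpoly_mxof (phi (sl2_e2 F))).

(* Main.v *)
From HB Require Import structures.
Require Import Defs.
From mathcomp Require Import all_boot all_order all_algebra.
From mathcomp Require Import reals complex mpoly.
From mathcomp Require Import ring.

Set Implicit Arguments.
Unset Strict Implicit.
Unset Printing Implicit Defensive.

Import GRing.Theory passmx.

Local Open Scope ring_scope.

(** The characteristic polynomial is multiplicative along an invariant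
    subspace, because a basis adapted to the subspace makes the pencil block
    triangular. In a nonzero representation, a highest weight vector v generates
    an invariant subspace with basis v, vF, ..., vF^m on which h, e1, e2 act by
    the explicit matrices of the irreducible representation of dimension m + 1
    ([irr_submodule]). By induction on the dimension, the characteristic
    polynomial of any representation is therefore a product of characteristic
    polynomials of irreducible representations ([triple_charpolyP]). Conversely,
    direct sums of irreducible representations realize every such product
    ([triple_of_weights]).

    The irreducible factor of highest weight m has a tridiagonal pencil
    z + aH + bE + cF. If c = 2ta + t^2b, conjugation by exp(tF) carries
    aH + bE + cF to (a + tb)H + bE, so the pencil becomes triangular with
    diagonal z + s(m - 2i), where s = a + tb satisfies s^2 = a^2 + bc. Pairing
    opposite weights, the determinant is the product of z (if m is even) and of
    the z^2 - n^2(a^2 + bc) with 0 < n <= m and n of the parity of m. Both sides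
    are polynomial in c and agree for infinitely many c, hence they agree for
    every c ([det_irr_pencil]).

    What remains is combinatorial. In a product over highest weights m the
    factor of index n occurs d n times, where d n counts the m >= n of the
    parity of n. Such d are exactly the finitely supported sequences with
    d (n + 2) <= d n: the weight m has to be taken d m - d (m + 2) times
    ([exists_weights]). *)

(** * Pencils and sl2-triples of matrices *)

Definition pencil (A : comNzRingType) n (z a b c : A) (H E F : 'M[A]_n) :=
  z%:M + a *: H + b *: E + c *: F.

(** The relations [h,e] = 2e, [h,f] = -2f, [e,f] = h, for matrices acting on row
    vectors from the right: the product E *m H is first E, then H. *)
Definition sl2_triple (A : comNzRingType) n (H E F : 'M[A]_n) : Prop :=
  [/\ E *m H - H *m E = E *+ 2, F *m H - H *m F = - (F *+ 2)
    & F *m E - E *m F = H].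

Lemma pencil_intertwine (A : comNzRingType) p n (P : 'M[A]_(p, n)) z a b c
    H E F H' E' F' :
    P *m H = H' *m P -> P *m E = E' *m P -> P *m F = F' *m P ->
  P *m pencil z a b c H E F = pencil z a b c H' E' F' *m P.
Proof.
move=> PH PE PF; rewrite /pencil !mulmxDr !mulmxDl mul_mx_scalar mul_scalar_mx.
by rewrite -!scalemxAr -!scalemxAl PH PE PF.
Qed.

(** * The irreducible matrices *)

Section IrreducibleMatrices.
Variables (A : comNzRingType) (m : nat).

(** The entries are functions of natural numbers, so that shifted indices need
    no proof that they are in range. The basis is w_i = v F^i / i!, for which
    w_i H = (m - 2i) w_i, w_i E = (m - i + 1) w_(i-1) and
    w_i F = (i + 1) w_(i+1). *)
Definition entryH (i j : nat) : A := (m%:R - (i.*2)%:R) *+ (i == j).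
Definition entryE (i j : nat) : A := (m - j)%:R *+ (i == j.+1).
Definition entryF (i j : nat) : A := j%:R *+ (j == i.+1).

Definition irrH : 'M[A]_m.+1 := \matrix_(i, j) entryH i j.
Definition irrE : 'M[A]_m.+1 := \matrix_(i, j) entryE i j.
Definition irrF : 'M[A]_m.+1 := \matrix_(i, j) entryF i j.

Lemma sum_ord_pick n (j : nat) (x : nat -> A) :
  \sum_(k < n) x k *+ (k == j :> nat) = x j *+ (j < n)%N.
Proof.
case: ltnP => [ltjn|lenj].
  rewrite (bigD1 (Ordinal ltjn)) //= eqxx big1 ?addr0 // => k neq.
  by have /negPf-> : k != j :> nat by [].
rewrite big1 // => k _.
by rewrite (ltn_eqF (leq_trans (ltn_ord k) lenj)).
Qed.

(* With x defined on all naturals, the products below need no boundary cases: a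
   shifted index leaves the range only where its coefficient vanishes. *)
Variables (M : 'M[A]_m.+1) (x : nat -> nat -> A).
Hypothesis Mx : forall i j : 'I_m.+1, M i j = x i j.

Lemma mul_irrH i j : (M *m irrH) i j = x i j * (m%:R - (j.*2)%:R).
Proof.
rewrite mxE; under eq_bigr => k _ do rewrite Mx !mxE mulrnAr.
by rewrite (@sum_ord_pick _ j (fun k => x i k * (m%:R - (k.*2)%:R))) ltn_ord.
Qed.

Lemma mul_irrE i j : (M *m irrE) i j = x i j.+1 * (m - j)%:R.
Proof.
rewrite mxE; under eq_bigr => k _ do rewrite Mx !mxE mulrnAr.
rewrite (@sum_ord_pick _ j.+1 (fun k => x i k * (m - j)%:R)) ltnS.
case: ltnP => // lemj; have -> : (m - j = 0)%N by apply/eqP.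
by rewrite mulr0.
Qed.

Lemma mul_irrF i j : (M *m irrF) i j = x i j.-1 * j%:R.
Proof.
case: j => [[|j] ltj]; rewrite !mxE /=.
  by rewrite mulr0 big1 // => k _; rewrite !mxE /entryF mulr0n mulr0.
under eq_bigr => k _ do rewrite Mx !mxE mulrnAr /= eqSS eq_sym.
by rewrite (@sum_ord_pick _ j (fun k => x i k * j.+1%:R)) ltnW.
Qed.

End IrreducibleMatrices.

Section IrreducibleLeftMul.
Variables (A : comNzRingType) (m p : nat).
Variables (M : 'M[A]_(m.+1, p)) (x : nat -> 'I_p -> A).
Hypothesis Mx : forall i j, M i j = x i j.

Lemma irrH_mul i j : (irrH A m *m M) i j = (m%:R - (i.*2)%:R) * x i j.
Proof.
rewrite mxE; under eq_bigr => k _ do rewrite Mx !mxE mulrnAl eq_sym.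
by rewrite (@sum_ord_pick _ _ i (fun k => (m%:R - (i.*2)%:R) * x k j)) ltn_ord.
Qed.

Lemma irrE_mul i j :
  (irrE A m *m M) i j = (m.+1 - i)%:R * x i.-1 j *+ (0 < i)%N.
Proof.
case: i => [[|i] lti]; rewrite !mxE /=.
  by rewrite big1 // => k _; rewrite !mxE /entryE mulr0n mul0r.
under eq_bigr => k _ do rewrite Mx !mxE mulrnAl /= eqSS eq_sym.
by rewrite (@sum_ord_pick _ _ i (fun k => (m - k)%:R * x k j)) ltnW // subSS.
Qed.

Lemma irrF_mul i j : x m.+1 j = 0 -> (irrF A m *m M) i j = i.+1%:R * x i.+1 j.
Proof.
move=> x0; rewrite mxE; under eq_bigr => k _ do rewrite Mx !mxE mulrnAl.
rewrite (@sum_ord_pick _ _ i.+1 (fun k => k%:R * x k j)) ltnS.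
case: ltngtP (ltnSE (ltn_ord i)) => // -> _; by rewrite x0 mulr0.
Qed.

End IrreducibleLeftMul.

Lemma irr_triple (A : comNzRingType) m :
  sl2_triple (irrH A m) (irrE A m) (irrF A m).
Proof.
have hE i j : irrH A m i j = entryH A m i j by rewrite mxE.
have eE i j : irrE A m i j = entryE A m i j by rewrite mxE.
have fE i j : irrF A m i j = entryF A i j by rewrite mxE.
rewrite /sl2_triple !mulr2n; split; apply/matrixP=> i j;
  rewrite [LHS]mxE [X in _ + X]mxE.
- rewrite (mul_irrH eE) (mul_irrE hE) [RHS]mxE eE /entryE /entryH.
  by case: eqP => [->|_]; rewrite ?mulr0n ?mulr1n ?doubleS; ring.
- rewrite (mul_irrH fE) (mul_irrF hE) [RHS]mxE [in RHS]mxE fE /entryF /entryH.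
  case: j => [[|j] ltj] /=; first by rewrite !mulr0n; ring.
  rewrite eqSS eq_sym.
  by case: eqP => [->|_]; rewrite ?mulr0n ?mulr1n ?doubleS; ring.
- rewrite (mul_irrE fE) (mul_irrF eE) hE /entryF /entryE /entryH.
  case: j => [[|j] ltj] /=; rewrite !eqSS eq_sym.
    rewrite subn0.
    by case: eqP => [->|_]; rewrite ?mulr0n ?mulr1n ?double0; ring.
  case: eqP => [->|_]; last by rewrite ?mulr0n; ring.
  have ltjm : (j < m)%N by [].
  rewrite -(subnSK ltjm) -{3}(subnK ltjm); move: (m - j.+1)%N => k.
  by rewrite !mulr1n doubleS -addnn; ring.
Qed.

(** * The characteristic polynomial of an irreducible representation *)

(** The matrix of exp(tF) in the basis w_i. *)
Definition irr_exp (A : comNzRingType) m (t : A) : 'M[A]_m.+1 :=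
  \matrix_(i, j) (t ^+ (j - i) *+ 'C(j, i)).

Lemma det_irr_exp (A : comNzRingType) m (t : A) : \det (irr_exp m t) = 1.
Proof.
rewrite -det_tr det_trig.
  by rewrite big1 // => i _; rewrite !mxE subnn binn.
by apply/is_trig_mxP => i j ltij; rewrite !mxE bin_small ?mulr0n.
Qed.

(** This is the adjoint action of exp(tF) on aH + bE + cF, with c chosen to
    cancel the F-component. *)
Lemma irr_exp_pencil (A : comNzRingType) m (z a b t : A) :
  irr_exp m t *m pencil z a b (t *+ 2 * a + t ^+ 2 * b)
    (irrH A m) (irrE A m) (irrF A m) =
  pencil z (a + t * b) b 0 (irrH A m) (irrE A m) (irrF A m) *m irr_exp m t.
Proof.
pose p i j : A := t ^+ (j - i) *+ 'C(j, i).
have pE i j : irr_exp m t i j = p i j by rewrite mxE.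
have addE (M N : 'M[A]_m.+1) i j : (M + N) i j = M i j + N i j by rewrite mxE.
have scaleE c (M : 'M[A]_m.+1) i j : (c *: M) i j = c * M i j by rewrite mxE.
rewrite /pencil !mulmxDr !mulmxDl mul_mx_scalar mul_scalar_mx.
rewrite -!scalemxAr -!scalemxAl scale0r addr0.
apply/matrixP=> i j; rewrite !(addE, scaleE).
rewrite (mul_irrH pE) (mul_irrE pE) (mul_irrF pE).
rewrite (@irrH_mul _ m _ _ (fun i j => p i j) pE).
rewrite (@irrE_mul _ m _ _ (fun i j => p i j) pE).
rewrite !pE /p {p pE addE scaleE}; case: i j => [i lti] [j ltj] /=.
have := subnK (ltnSE ltj); move: (m - j)%N => q m_eq; subst m => {lti ltj}.
(* Both c-terms contain a factor t, which restores the exponent j - i; the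
   binomials then combine by j C(j-1, i) = (j - i) C(j, i). *)
have lowerF : t * (t ^+ (j.-1 - i) *+ 'C(j.-1, i) * j%:R) =
    t ^+ (j - i) *+ ((j - i) * 'C(j, i)).
  rewrite -mul_bin_down; case: j => [|j] /=; first by rewrite mul0n !mulr0.
  case: (leqP i j) => [leij|ltji]; first by rewrite subSn // exprS; ring.
  by rewrite (bin_small ltji) muln0 !mulr0n; ring.
rewrite mulrDl -(mulrA (t *+ 2)) [t *+ 2]mulr2n.
have -> : (t + t) * (a * (t ^+ (j.-1 - i) *+ 'C(j.-1, i) * j%:R)) =
    2%:R * a * (t ^+ (j - i) *+ ((j - i) * 'C(j, i))) by rewrite -lowerF; ring.
have -> : t ^+ 2 * b * (t ^+ (j.-1 - i) *+ 'C(j.-1, i) * j%:R) =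
    t * b * (t ^+ (j - i) *+ ((j - i) * 'C(j, i))) by rewrite -lowerF; ring.
case: i {lowerF} => [|i] /=; first by rewrite !bin0 !subn0 exprS -!addnn; ring.
rewrite subSS mulr1n subSS.
case: (ltngtP i j) => [ltij|ltji|->]; last first.
- rewrite !binn bin_small // subnn addnK !muln0 !mulr0n; ring.
- by rewrite binS (bin_small ltji) (bin_small (leqW ltji)) ?muln0 !mulr0n; ring.
have := mul_bin_left j i; rewrite binS; set x := 'C(j, i.+1); set y := 'C(j, i).
rewrite -(subnSK ltij); have := subnK ltij; clearbody x y.
move: (j - i.+1)%N => r <- eqC {ltij}; rewrite addnS -addSn addnA addnK.
have {}eqC : i.+1%:R * x%:R = r.+1%:R * y%:R :> A by rewrite -!natrM eqC.
apply/eqP; rewrite -subr_eq0; apply/eqP.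
(* The a-terms cancel, and the b-terms leave a multiple of the relation
   (i + 1) C(j, i+1) = (j - i) C(j, i). *)
transitivity (b * t ^+ r.+1 * (i.+1%:R * x%:R - r.+1%:R * y%:R)).
  by rewrite -!addnn !exprS; ring.
by rewrite eqC subrr mulr0.
Qed.

(** The contribution of the weights n and -n; q stands for a^2 + bc, the square
    of the eigenvalue s of the element with coordinates a, b, c. *)
Definition weight_factor (A : comNzRingType) (z q : A) (n : nat) : A :=
  if n is 0%N then z else z ^+ 2 - (n ^ 2)%:R * q.

Definition irr_charpoly (A : comNzRingType) (z q : A) (m : nat) : A :=
  \prod_(n < m.+1 | odd n == odd m) weight_factor z q n.

Lemma irr_charpolyS2 (A : comNzRingType) (z q : A) m :
  irr_charpoly z q m.+2 = irr_charpoly z q m * weight_factor z q m.+2.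
Proof.
rewrite /irr_charpoly [LHS]big_mkcond [X in _ = X * _]big_mkcond /=.
rewrite !big_ord_recr /= negbK eqxx.
by case: (odd m); rewrite /= ?mulr1.
Qed.

(** The first and last of the factors of m + 2 have product
    z^2 - (m + 2)^2 s^2, and the others are the factors of m. *)
Lemma prod_weights (A : comNzRingType) (z s : A) m :
  \prod_(i < m.+1) (z + s * (m%:R - (i.*2)%:R)) = irr_charpoly z (s ^+ 2) m.
Proof.
elim/ltn_ind: m => -[|[|m]] IHm.
- rewrite /irr_charpoly [RHS]big_mkcond !big_ord1 double0 /= /weight_factor.
  by ring.
- rewrite /irr_charpoly [RHS]big_mkcond !big_ord_recr !big_ord0 /=.
  by rewrite /weight_factor doubleS double0 exp1n; ring.
rewrite irr_charpolyS2 -IHm // big_ord_recl big_ord_recr /= /weight_factor.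
have -> : \prod_(i < m.+1) (z + s * (m.+2%:R - (bump 0 i).*2%:R)) =
          \prod_(i < m.+1) (z + s * (m%:R - i.*2%:R)).
  by apply: eq_bigr => i _; rewrite /bump leq0n add1n doubleS; ring.
by rewrite /bump leq0n add1n double0 -addnn expnS expn1; ring.
Qed.

Lemma det_irr_pencil_special (A : comNzRingType) (z a b t : A) m :
  \det (pencil z a b (t *+ 2 * a + t ^+ 2 * b)
          (irrH A m) (irrE A m) (irrF A m)) =
  irr_charpoly z ((a + t * b) ^+ 2) m.
Proof.
have := congr1 determinant (irr_exp_pencil m z a b t).
rewrite !det_mulmx det_irr_exp mul1r mulr1 => ->.
rewrite -prod_weights det_trig.
  apply: eq_bigr => i _; rewrite !mxE /entryH /entryE /entryF eqxx.
  rewrite (ltn_eqF (ltnSn i)) eqxx !mulr0n !mulr1n; ring.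
apply/is_trig_mxP => i j ltij; rewrite !mxE /entryH /entryE /entryF.
rewrite -val_eqE /= (ltn_eqF ltij) (ltn_eqF (ltnW _)) // !mulr0n; ring.
Qed.

Section Morphism.
Variables (A B : comNzRingType) (f : {rmorphism A -> B}).

Lemma map_pencil n (z a b c : A) (H E F : 'M[A]_n) :
  map_mx f (pencil z a b c H E F) =
  pencil (f z) (f a) (f b) (f c) (map_mx f H) (map_mx f E) (map_mx f F).
Proof. by rewrite /pencil !map_mxD /= !map_mxZ map_scalar_mx. Qed.

Lemma map_irrH m : map_mx f (irrH A m) = irrH B m.
Proof.
by apply/matrixP=> i j; rewrite !mxE rmorphMn rmorphB !rmorph_nat.
Qed.

Lemma map_irrE m : map_mx f (irrE A m) = irrE B m.
Proof. by apply/matrixP=> i j; rewrite !mxE rmorphMn rmorph_nat. Qed.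

Lemma map_irrF m : map_mx f (irrF A m) = irrF B m.
Proof. by apply/matrixP=> i j; rewrite !mxE rmorphMn rmorph_nat. Qed.

Lemma rmorph_irr_charpoly (z q : A) m :
  f (irr_charpoly z q m) = irr_charpoly (f z) (f q) m.
Proof.
rewrite rmorph_prod; apply: eq_bigr => -[[|n] ltn] _ //=.
by rewrite rmorphB rmorphXn rmorphM rmorph_nat.
Qed.

End Morphism.

(** For fixed z, a, b both sides are polynomials in c, and
    [det_irr_pencil_special] gives their equality at c = 2ta + t^2b. The
    hypothesis provides infinitely many such c, already for t = 0, 1, 2, ... *)
Lemma det_irr_pencil (A : idomainType) (z a b c : A) m :
  injective (fun n : nat => n%:R *+ 2 * a + n%:R ^+ 2 * b) ->
  \det (pencil z a b c (irrH A m) (irrE A m) (irrF A m)) =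
  irr_charpoly z (a ^+ 2 + b * c) m.
Proof.
set t := (fun n : nat => _) => inj_t.
pose d : {poly A} :=
  \det (pencil z%:P a%:P b%:P 'X (irrH _ m) (irrE _ m) (irrF _ m)).
pose g : {poly A} := irr_charpoly z%:P (a%:P ^+ 2 + b%:P * 'X) m.
have dE x : d.[x] = \det (pencil z a b x (irrH _ m) (irrE _ m) (irrF _ m)).
  rewrite -horner_evalE -det_map_mx map_pencil map_irrH map_irrE map_irrF.
  by rewrite /= /horner_eval !hornerC hornerX.
have gE x : g.[x] = irr_charpoly z (a ^+ 2 + b * x) m.
  rewrite -horner_evalE rmorph_irr_charpoly rmorphD rmorphXn rmorphM /=.
  by rewrite /= /horner_eval !hornerC hornerX.
suff /eqP dg0 : d - g == 0 by rewrite -dE -gE -[d](subrK g) dg0 add0r.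
apply/idPn => nz_dg.
pose rs := [seq t n | n <- iota 0 (size (d - g))].
suff: (size rs < size (d - g)%R)%N by rewrite size_map size_iota ltnn.
apply: max_poly_roots => //; last by rewrite map_inj_uniq ?iota_uniq.
apply/allP => _ /mapP[n _ ->]; rewrite rootE hornerD hornerN dE gE.
rewrite det_irr_pencil_special subr_eq0; apply/eqP; congr irr_charpoly.
by rewrite /t; ring.
Qed.

(** * Highest weight vectors *)

Section HighestWeight.
Variable C : numClosedFieldType.

Definition mulmx_iter n (X : 'M[C]_n) (v : 'rV[C]_n) k : 'rV[C]_n :=
  iter k (mulmx^~ X) v.

Lemma mulmx_iter_weight n (H X : 'M[C]_n) v (a c : C) k :
    X *m H - H *m X = c *: X -> v *m H = a *: v ->
  mulmx_iter X v k *m H = (a + k%:R * c) *: mulmx_iter X v k.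
Proof.
move=> /(canRL (subrK _)) XH vH; elim: k => [|k IHk].
  by rewrite mul0r addr0.
rewrite /= -mulmxA XH mulmxDr -scalemxAr mulmxA IHk -scalemxAl -scalerDl.
by congr (_ *: _); rewrite -natr1; ring.
Qed.

(** The nonzero iterates are eigenvectors of H for distinct eigenvalues, of
    which there are at most n. *)
Lemma mulmx_iter_ends n (H X : 'M[C]_n) v (a c : C) :
    c != 0 -> X *m H - H *m X = c *: X -> v != 0 -> v *m H = a *: v ->
  exists k, mulmx_iter X v k != 0 /\ mulmx_iter X v k.+1 = 0.
Proof.
move=> nz_c XH nz_v vH.
have ex0 : exists k, mulmx_iter X v k == 0.
  case: (pickP [pred k : 'I_n.+1 | mulmx_iter X v k == 0]) => [k|nz].
    by exists k.
  pose rs := [seq a + k%:R * c | k <- iota 0 n.+1].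
  have: (size rs < size (char_poly H))%N.
    apply: max_poly_roots; first exact/monic_neq0/char_poly_monic.
    - apply/allP => _ /mapP[k + ->]; rewrite mem_iota => ltkn.
      rewrite -eigenvalue_root_char; apply/eigenvalueP.
      exists (mulmx_iter X v k); first exact: mulmx_iter_weight.
      exact: negbT (nz (Ordinal ltkn)).
    rewrite map_inj_uniq ?iota_uniq // => i j /addrI /(mulIf nz_c) /eqP.
    by rewrite Num.Theory.eqr_nat => /eqP.
  by rewrite size_map size_iota size_char_poly ltnn.
case: (ex_minnP ex0) => -[|k] /eqP vk0 min_k; first by case/eqP: nz_v.
exists k; split=> //; apply/negP => /min_k; by rewrite ltnn.
Qed.

Lemma highest_weight_vector n (H E F : 'M[C]_n) :
    (0 < n)%N -> sl2_triple H E F ->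
  exists (v : 'rV[C]_n) (l : C), [/\ v != 0, v *m H = l *: v & v *m E = 0].
Proof.
move=> n_gt0 [EH _ _].
have [a /eigenvalueP[u uH nz_u]] := eigenvalue_closed H n_gt0.
have {}EH : E *m H - H *m E = 2%:R *: E by rewrite scaler_nat.
have nz2 : 2%:R != 0 :> C by rewrite Num.Theory.pnatr_eq0.
have [k [nz_k k_top]] := mulmx_iter_ends nz2 EH nz_u uH.
exists (mulmx_iter E u k), (a + k%:R * 2%:R).
by split=> //; apply: mulmx_iter_weight.
Qed.

(** If x U = 0, then multiplying by the powers of H gives
    sum_i d_i^k x_i U_i = 0 for all k, a Vandermonde system for the vectors
    x_i U_i. *)
Lemma eigenvectors_free n m (H : 'M[C]_n) (U : 'M[C]_(m, n)) (d : 'I_m -> C) :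
    injective d -> (forall i, row i U != 0) ->
    (forall i, row i U *m H = d i *: row i U) ->
  row_free U.
Proof.
move=> inj_d nzU UH; apply: inj_row_free => x xU0.
have powers k : \sum_i (d i ^+ k * x 0 i) *: row i U = 0.
  elim: k => [|k IHk].
    rewrite -[RHS]xU0 mulmx_sum_row; apply: eq_bigr => i _.
    by rewrite expr0 mul1r.
  have := congr1 (mulmx^~ H) IHk; rewrite mul0mx mulmx_suml => {2}<-.
  apply: eq_bigr => i _; rewrite -scalemxAl UH scalerA exprS.
  by congr (_ *: _); ring.
pose V := Vandermonde m (\row_i d i).
pose Y := \matrix_i (x 0 i *: row i U).
have VY0 : V *m Y = 0.
  apply/row_matrixP => k; rewrite row_mul mulmx_sum_row row0 -[RHS](powers k).
  by apply: eq_bigr => i _; rewrite !mxE rowK scalerA.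
have uV : V \in unitmx.
  rewrite unitmxE unitfE det_Vandermonde; apply/prodf_neq0 => i _.
  apply/prodf_neq0 => j ltij; rewrite !mxE subr_eq0.
  by apply: contraTneq ltij => /inj_d ->; rewrite ltnn.
apply/rowP => i; rewrite mxE.
have := congr1 (row i) (etrans (esym (mulKmx uV Y)) (congr1 _ VY0)).
rewrite mulmx0 rowK row0 => /eqP; rewrite scaler_eq0 (negPf (nzU i)) orbF.
by move/eqP.
Qed.

(** The rows of U are the vectors w_i = v F^i / i! for a highest weight
    vector v, up to the last nonzero one, w_m. Applying E to w_(m+1) = 0 gives
    (l - m) w_m = 0, which identifies the weight l of v with m. *)
Lemma irr_submodule n (H E F : 'M[C]_n) :
    (0 < n)%N -> sl2_triple H E F ->
  exists (m : nat) (U : 'M[C]_(m.+1, n)),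
    [/\ row_free U, U *m H = irrH C m *m U, U *m E = irrE C m *m U
      & U *m F = irrF C m *m U].
Proof.
move=> n_gt0 HEF; have [v [l [nz_v vH vE]]] := highest_weight_vector n_gt0 HEF.
case: HEF => _ FH FE.
have {}FH : F *m H - H *m F = (- 2%:R) *: F by rewrite FH scaleNr scaler_nat.
have nz2 : - 2%:R != 0 :> C by rewrite oppr_eq0 Num.Theory.pnatr_eq0.
have [m [nz_m m_top]] := mulmx_iter_ends nz2 FH nz_v vH.
pose w k := (k`!%:R)^-1 *: mulmx_iter F v k.
have nzfact k : (k`!)%:R != 0 :> C.
  by rewrite Num.Theory.pnatr_eq0 -lt0n fact_gt0.
have wF k : w k *m F = k.+1%:R *: w k.+1.
  rewrite /w -scalemxAl scalerA /=; congr (_ *: _).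
  rewrite factS natrM invfM mulrA divff ?mul1r //.
  by rewrite Num.Theory.pnatr_eq0.
have wH k : w k *m H = (l - (k.*2)%:R) *: w k.
  rewrite /w -scalemxAl (mulmx_iter_weight k FH vH) !scalerA; congr (_ *: _).
  by rewrite -addnn; ring.
have wE k : w k *m E = (l - k.-1%:R) *: w k.-1 *+ (0 < k)%N.
  elim: k => [|k IHk]; first by rewrite /w -scalemxAl vE scaler0.
  apply: (@scalerI _ _ k.+1%:R); first by rewrite Num.Theory.pnatr_eq0.
  rewrite scalemxAl -wF -mulmxA.
  have -> : F *m E = H + E *m F by rewrite -FE subrK.
  rewrite mulmxDr wH mulmxA IHk /=; case: k {IHk} => [|k] /=.
    by rewrite mulr0n mul0mx addr0 scale1r subr0.
  rewrite mulr1n -scalemxAl wF !scalerA -scalerDl; congr (_ *: _).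
  by rewrite doubleS -addnn; ring.
have wm0 : w m.+1 = 0 by rewrite /w m_top scaler0.
have nz_w k : (k <= m)%N -> w k != 0.
  move=> lekm; rewrite /w scaler_eq0 invr_eq0 negb_or nzfact /=.
  apply: contraNneq nz_m => vk0; rewrite -(subnK lekm).
  by elim: (m - k)%N => [|i IHi]; rewrite ?vk0 //= (eqP IHi) mul0mx.
have l_m : l = m%:R.
  apply/eqP; rewrite -subr_eq0; have := wE m.+1.
  rewrite wm0 mul0mx /= => /esym/eqP.
  by rewrite mulr1n scaler_eq0 (negPf (nz_w m (leqnn m))) orbF.
pose U := \matrix_(i < m.+1) w i.
have UE i j : U i j = w i 0 j by rewrite !mxE.
exists m, U; split.
- apply: (@eigenvectors_free _ _ H _ (fun i => l - (i.*2)%:R)) => [i j|i|i].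
  + move=> /addrI /oppr_inj /eqP; rewrite Num.Theory.eqr_nat => /eqP.
    by move/double_inj/val_inj.
  + by rewrite rowK nz_w // -ltnS.
  + by rewrite rowK wH.
- apply/row_matrixP => i; rewrite row_mul rowK wH l_m; apply/rowP => j.
  by rewrite [RHS]mxE (irrH_mul (x := fun i => w i 0) UE) mxE.
- apply/row_matrixP => i; rewrite row_mul rowK wE l_m; apply/rowP => j.
  rewrite [RHS]mxE (irrE_mul (x := fun i => w i 0) UE).
  case: i => [[|i] lti] /=; first by rewrite mxE.
  by rewrite !mulr1n mxE subSS natrB // ltnW.
- apply/row_matrixP => i; rewrite row_mul rowK wF; apply/rowP => j.
  by rewrite [RHS]mxE (irrF_mul (x := fun i => w i 0) UE) ?wm0 ?mxE.
Qed.

End HighestWeight.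

(** * Characteristic polynomials of sl2-triples *)

Section GenericPencil.
Variable C : numClosedFieldType.

Definition triple_charpoly n (H E F : 'M[C]_n) : {mpoly C[4]} :=
  \det (pencil (zvar C 0) (zvar C 1) (zvar C 2) (zvar C 3)
          (map_mx (@mpolyC 4 C) H) (map_mx (@mpolyC 4 C) E)
          (map_mx (@mpolyC 4 C) F)).

(** Minus the determinant of the generic element z1 h + z2 e1 + z3 e2. *)
Definition norm_form : {mpoly C[4]} := zvar C 1 ^+ 2 + zvar C 2 * zvar C 3.

Lemma triple_charpoly_irr m :
  triple_charpoly (irrH C m) (irrE C m) (irrF C m) =
  irr_charpoly (zvar C 0) norm_form m.
Proof.
rewrite /triple_charpoly map_irrH map_irrE map_irrF det_irr_pencil // => i j.
(* Evaluating at z1 = 1, z2 = 0 turns 2 i z1 + i^2 z2 into 2 i. *)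
move/(congr1 (meval (fun k : 'I_4 => (k == inord 1)%:R))).
rewrite /zvar !(mevalD, mevalM, rmorphXn, rmorphMn, rmorph_nat) /= !mevalXU.
have -> : (inord 2 == inord 1 :> 'I_4) = false.
  by apply/eqP => /(congr1 val); rewrite !val_insubd.
rewrite eqxx !meval1 !mulr0 !addr0 !mulr1 -!mulrnDr => /eqP.
by rewrite Num.Theory.eqr_nat !addnn => /eqP/double_inj.
Qed.

Lemma triple_charpoly_lblock r p (H1 E1 F1 : 'M[C]_r)
    (H2 E2 F2 : 'M[C]_p) H3 E3 F3 :
  triple_charpoly (block_mx H1 0 H3 H2) (block_mx E1 0 E3 E2)
    (block_mx F1 0 F3 F2) =
  triple_charpoly H1 E1 F1 * triple_charpoly H2 E2 F2.
Proof.
rewrite /triple_charpoly /pencil !map_block_mx !map_mx0 !scale_block_mx.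
rewrite (scalar_mx_block r p) !add_block_mx.
by rewrite !scaler0 !addr0 det_lblock.
Qed.

Lemma triple_charpoly_sim n (P H E F H' E' F' : 'M[C]_n) :
    P \in unitmx -> P *m H = H' *m P -> P *m E = E' *m P -> P *m F = F' *m P ->
  triple_charpoly H E F = triple_charpoly H' E' F'.
Proof.
move=> uP PH PE PF; pose Q := map_mx (@mpolyC 4 C) P.
have uQ : \det Q != 0 by rewrite det_map_mx mpolyC_eq0 -unitfE -unitmxE.
apply: (mulfI uQ); rewrite [RHS]mulrC -!det_mulmx; congr (\det _).
by apply: pencil_intertwine; rewrite -!map_mxM ?PH ?PE ?PF.
Qed.

Lemma sl2_triple_sim n (P H E F : 'M[C]_n) :
    P \in unitmx -> sl2_triple H E F ->
  sl2_triple (P *m H *m invmx P) (P *m E *m invmx P) (P *m F *m invmx P).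
Proof.
move=> uP [EH FH FE].
have conjM X Y :
    P *m X *m invmx P *m (P *m Y *m invmx P) = P *m (X *m Y) *m invmx P.
  by rewrite !mulmxA mulmxKV.
rewrite /sl2_triple !mulr2n; split; rewrite !conjM -mulmxBl -mulmxBr.
- by rewrite EH mulr2n mulmxDr mulmxDl.
- by rewrite FH mulr2n mulmxN mulNmx mulmxDr mulmxDl.
- by rewrite FE.
Qed.

Lemma sl2_triple_lblock r p (H1 E1 F1 : 'M[C]_r)
    (H2 E2 F2 : 'M[C]_p) H3 E3 F3 :
    sl2_triple (block_mx H1 0 H3 H2) (block_mx E1 0 E3 E2)
      (block_mx F1 0 F3 F2) ->
  sl2_triple H1 E1 F1 /\ sl2_triple H2 E2 F2.
Proof.
rewrite /sl2_triple !mulr2n !mulmx_block !add_block_mx.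
rewrite !opp_block_mx !add_block_mx.
rewrite !mul0mx !mulmx0 !addr0 !add0r.
by case=> /eq_block_mx[? _ _ ?] /eq_block_mx[? _ _ ?] /eq_block_mx[? _ _ ?].
Qed.

Lemma row_free_complete r n (U : 'M[C]_(r, n)) : row_free U ->
  exists p (W : 'M[C]_(p, n)), n = (r + p)%N /\ row_full (col_mx U W).
Proof.
move=> freeU; exists (\rank U^C)%MS, (row_base U^C)%MS; split.
  by rewrite mxrank_compl (eqP freeU) subnKC // -(eqP freeU) rank_leq_col.
rewrite -sub1mx -addsmxE; apply: submx_trans (_ : 1%:M <= U + U^C)%MS _.
  by rewrite sub1mx addsmx_compl_full.
by rewrite addsmxS ?eq_row_base.
Qed.

(** Induction on n: completing the rows of [irr_submodule] to a basis makes
    the triple block triangular, with an irreducible block and the triple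
    induced on the quotient. *)
Lemma triple_charpolyP n (H E F : 'M[C]_n) : sl2_triple H E F ->
  exists ms : seq nat,
    triple_charpoly H E F = \prod_(m <- ms) irr_charpoly (zvar C 0) norm_form m.
Proof.
elim/ltn_ind: n H E F => -[|n] IHn H E F HEF.
  by exists [::]; rewrite big_nil /triple_charpoly det_mx00.
have [m [U [freeU UH UE UF]]] := irr_submodule (ltn0Sn n) HEF.
have [p [W [n_eq fullP]]] := row_free_complete freeU.
move: H E F U W HEF freeU UH UE UF fullP; rewrite n_eq.
move=> H E F U W HEF freeU UH UE UF.
rewrite row_full_unit; set P := col_mx U W => uP.
have blockP X (X1 : 'M_m.+1) : U *m X = X1 *m U ->
    exists X3 X2, P *m X *m invmx P = block_mx X1 0 X3 X2.
  move=> UX; set Y := P *m X *m invmx P.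
  have : usubmx Y = row_mx X1 0.
    rewrite /Y /P !mul_col_mx col_mxKu UX -mulmxA.
    have -> : U *m invmx P = row_mx 1%:M 0.
      rewrite -(col_mxKu U W) -/P mul_usub_mx mulmxV // scalar_mx_block.
      by rewrite /block_mx col_mxKu.
    by rewrite mul_mx_row mulmx1 mulmx0.
  move=> uY; exists (dlsubmx Y), (drsubmx Y).
  by rewrite -[LHS]vsubmxK uY -[dsubmx Y]hsubmxK.
have [H3 [H2 eH]] := blockP _ _ UH.
have [E3 [E2 eE]] := blockP _ _ UE.
have [F3 [F2 eF]] := blockP _ _ UF.
have := sl2_triple_sim uP HEF; rewrite eH eE eF => /sl2_triple_lblock[_ HEF2].
have [|ms ms_eq] := IHn p _ H2 E2 F2 HEF2.
  by rewrite n_eq addSn ltnS leq_addl.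
exists (m :: ms); rewrite big_cons -ms_eq -triple_charpoly_irr.
rewrite -(triple_charpoly_lblock _ _ _ _ _ _ H3 E3 F3) -eH -eE -eF.
by apply: (triple_charpoly_sim uP); rewrite mulmxKV.
Qed.

End GenericPencil.

(** * Representations and triples of matrices *)

Section Representations.
Variable C : numClosedFieldType.

Lemma sl2_tr0 (x : subvs_of (sl2 C)) : vsval x 1 1 = - vsval x 0 0.
Proof.
have := subvsP x; rewrite mem_sl2 /mxtrace !big_ord_recl big_ord0 addr0.
by rewrite addrC addr_eq0 => /eqP <-; congr (vsval x _ _); apply/val_inj.
Qed.

Lemma sl2_bracket_he1 : sl2_bracket (sl2_h C) (sl2_e1 C) = sl2_e1 C *+ 2.
Proof.
apply: subvs_inj; rewrite [RHS]raddfMn /= mulmxBl mulmxBr !mul_delta_mx_cond.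
by rewrite /= !mulr0n !mulr1n !subr0 !sub0r opprK mulr2n.
Qed.

Lemma sl2_bracket_he2 : sl2_bracket (sl2_h C) (sl2_e2 C) = - (sl2_e2 C *+ 2).
Proof.
apply: subvs_inj; rewrite [RHS]raddfN raddfMn /= mulmxBl mulmxBr.
rewrite !mul_delta_mx_cond.
by rewrite /= !mulr0n !mulr1n !subr0 !sub0r -opprD mulr2n.
Qed.

Lemma sl2_bracket_e1e2 : sl2_bracket (sl2_e1 C) (sl2_e2 C) = sl2_h C.
Proof. by apply: subvs_inj; rewrite /= !mul_delta_mx. Qed.

(** [mxof] acts on row vectors and so reverses products, which agrees with the
    convention of [sl2_triple]. *)
Lemma representation_triple (V : vectType C)
    (phi : 'Hom(subvs_of (sl2 C), 'End(V))) :
    sl2_representation phi ->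
  let M x := mxof (vbasis {:V}) (vbasis {:V}) (phi x) in
  sl2_triple (M (sl2_h C)) (M (sl2_e1 C)) (M (sl2_e2 C)).
Proof.
move=> rep M; have bV := vbasisP {:V}.
have bracketM x y : M y *m M x - M x *m M y = M (sl2_bracket x y).
  by rewrite /M rep raddfB /= !(mxof_comp _ _ bV).
split.
- by rewrite bracketM sl2_bracket_he1 /M !raddfMn.
- by rewrite bracketM sl2_bracket_he2 /M !(raddfN, raddfMn).
- by rewrite bracketM sl2_bracket_e1e2.
Qed.

Lemma sl2_bracketE (x y : subvs_of (sl2 C)) i j :
  vsval (sl2_bracket x y) i j =
  vsval x i 0 * vsval y 0 j + vsval x i 1 * vsval y 1 j -
  (vsval y i 0 * vsval x 0 j + vsval y i 1 * vsval x 1 j).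
Proof.
have mulE (A B : 'M[C]_2) : (A *m B) i j = A i 0 * B 0 j + A i 1 * B 1 j.
  rewrite mxE !big_ord_recl big_ord0 addr0.
  by congr (_ + A i _ * B _ j); apply: val_inj.
by rewrite /= mxE [X in _ + X]mxE !mulE.
Qed.

Variables (V : vectType C).
Local Notation D := (\dim {:V}).
Variables (H E F : 'M[C]_D).

Definition rep_mx (x : subvs_of (sl2 C)) : 'M[C]_D :=
  vsval x 0 0 *: H + vsval x 0 1 *: E + vsval x 1 0 *: F.

Lemma rep_mx_bracket x y : sl2_triple H E F ->
  rep_mx (sl2_bracket x y) = rep_mx y *m rep_mx x - rep_mx x *m rep_mx y.
Proof.
case=> /(canRL (subrK _)) EH /(canRL (subrK _)) FH /(canRL (subrK _)) FE.
rewrite /rep_mx !sl2_bracketE !sl2_tr0.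
rewrite !mulmxDl !mulmxDr -!scalemxAl -!scalemxAr EH FH FE.
move: (H *m E) (H *m F) (E *m F) (H *m H) (E *m E) (F *m F).
by move=> HE HF EF HH EE FF; apply/matrixP=> i j; rewrite !mxE; ring.
Qed.

Definition rep_of_triple (x : subvs_of (sl2 C)) : 'End(V) :=
  hommx (vbasis {:V}) (vbasis {:V}) (rep_mx x).

Lemma rep_of_triple_linear : linear rep_of_triple.
Proof.
move=> a x y; rewrite /rep_of_triple -linearP; congr (hommx _ _ _).
by apply/matrixP=> i j; rewrite /rep_mx linearP !mxE; ring.
Qed.

HB.instance Definition _ := GRing.isLinear.Build C _ _ _ rep_of_triple
  rep_of_triple_linear.

Lemma mxof_rep_of_triple x :
  mxof (vbasis {:V}) (vbasis {:V}) (linfun rep_of_triple x) = rep_mx x.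
Proof. by rewrite lfunE (hommxK (vbasisP _) (vbasisP _)). Qed.

Lemma rep_of_tripleP : sl2_triple H E F ->
  sl2_representation (linfun rep_of_triple).
Proof.
move=> HEF x y; have bV := vbasisP {:V}.
apply: (can_inj (mxofK bV bV)); rewrite raddfB /= !(mxof_comp _ _ bV).
by rewrite !mxof_rep_of_triple rep_mx_bracket.
Qed.

Lemma sl2_charpoly_rep_of_triple :
  sl2_charpoly (linfun rep_of_triple) = triple_charpoly H E F.
Proof.
have mxh : rep_mx (sl2_h C) = H.
  by rewrite /rep_mx /= !mxE /= !subr0 !scale0r scale1r !addr0.
have mxe1 : rep_mx (sl2_e1 C) = E.
  by rewrite /rep_mx /= !mxE /= !scale0r scale1r add0r addr0.
have mxe2 : rep_mx (sl2_e2 C) = F.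
  by rewrite /rep_mx /= !mxE /= !scale0r scale1r !add0r.
by rewrite /sl2_charpoly /mpoly_mxof !mxof_rep_of_triple mxh mxe1 mxe2.
Qed.

End Representations.

Section Realization.
Variable C : numClosedFieldType.

Lemma triple_of_weights (ms : seq nat) :
  exists n (H E F : 'M[C]_n), sl2_triple H E F /\
    triple_charpoly H E F =
    \prod_(m <- ms) irr_charpoly (zvar C 0) (norm_form C) m.
Proof.
elim: ms => [|m ms [n [H [E [F [[EH FH FE] HEF]]]]]].
  exists 0%N, 0, 0, 0; rewrite big_nil /triple_charpoly det_mx00.
  by split=> //; split; apply/matrixP => -[].
exists (m.+1 + n)%N, (block_mx (irrH C m) 0 0 H), (block_mx (irrE C m) 0 0 E),
  (block_mx (irrF C m) 0 0 F).
rewrite triple_charpoly_lblock HEF triple_charpoly_irr big_cons; split=> //.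
have [EHm FHm FEm] := irr_triple C m.
rewrite /sl2_triple !mulr2n !mulmx_block !add_block_mx.
rewrite !opp_block_mx !add_block_mx.
rewrite !mul0mx !mulmx0 !addr0 !add0r !oppr0 ?addr0.
by rewrite EHm FHm FEm EH FH FE !mulr2n.
Qed.

Lemma representation_charpolyP (f : {mpoly C[4]}) :
  (exists (V : vectType C) (phi : 'Hom(subvs_of (sl2 C), 'End(V))),
      sl2_representation phi /\ f = sl2_charpoly phi) <->
  (exists ms : seq nat,
      f = \prod_(m <- ms) irr_charpoly (zvar C 0) (norm_form C) m).
Proof.
split=> [[V [phi [/representation_triple rep ->]]] | [ms ->]].
  exact: triple_charpolyP rep.
have [n [H [E [F [HEF <-]]]]] := triple_of_weights ms.
have dimV : \dim {:'rV[C]_n} = n by rewrite dimvf /dim /= mul1n.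
(* The two matrix sizes are only provably equal, so the triple is transported
   along dimV. *)
have : exists H' E' F' : 'M[C]_(\dim {:'rV[C]_n}),
    sl2_triple H' E' F' /\ triple_charpoly H' E' F' = triple_charpoly H E F.
  by rewrite dimV; exists H, E, F.
case=> [H' [E' [F' [HEF' <-]]]].
exists 'rV[C]_n, (linfun (rep_of_triple H' E' F')).
by split; [exact: rep_of_tripleP | rewrite sl2_charpoly_rep_of_triple].
Qed.

End Realization.

(** * Multiplicities of weights *)

Section Multiplicities.

(** The multiplicity of the weight n in the direct sum of the irreducible
    representations with highest weights ms. *)
Definition weight_mult (ms : seq nat) (n : nat) : nat :=
  count (fun m => (n <= m)%N && (odd n == odd m)) ms.

Lemma weight_multS2 ms n : (weight_mult ms n.+2 <= weight_mult ms n)%N.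
Proof.
by apply: sub_count => m /= /andP[/ltnW/ltnW -> ]; rewrite negbK.
Qed.

Lemma weight_mult_large ms N n :
  all (fun m => m <= N)%N ms -> (N < n)%N -> weight_mult ms n = 0%N.
Proof.
move=> /allP leN ltNn; apply/eqP; rewrite -leqn0 leqNgt -has_count; apply/hasPn.
by move=> m /leN lemN; rewrite leqNgt (leq_ltn_trans lemN ltNn).
Qed.

Lemma weight_mult_rec ms n :
  weight_mult ms n = (count_mem n ms + weight_mult ms n.+2)%N.
Proof.
rewrite /weight_mult; elim: ms => //= m ms ->.
rewrite negbK addnACA; congr addn.
case: (ltngtP n m) => [ltnm|ltmn|->]; last by rewrite eqxx ltnNge leqnSn.
  move: ltnm; rewrite leq_eqVlt => /predU1P[<-|->] //=.
  by rewrite ltnn; case: (odd n).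
by rewrite ltnNge ltnW // ltnW.
Qed.

(** Taking the highest weight m with multiplicity d m - d (m + 2), the sums of
    these differences telescope by [weight_mult_rec], downwards from N. *)
Lemma exists_weights (d : nat -> nat) N :
    (forall n, (N < n)%N -> d n = 0%N) -> (forall n, (d n.+2 <= d n)%N) ->
  exists2 ms, all (fun m => m <= N)%N ms & weight_mult ms =1 d.
Proof.
move=> d0 d_dec; pose c n := (d n - d n.+2)%N.
pose ms := flatten [seq nseq (c m) m | m <- iota 0 N.+1].
have leN : all (fun m => m <= N)%N ms.
  apply/allP => m /flatten_mapP[k]; rewrite mem_iota => lekN.
  by rewrite mem_nseq => /andP[_ /eqP->].
have countE n : (n <= N)%N -> count_mem n ms = c n.
  move=> lenN; rewrite count_flatten sumnE !big_map.
  rewrite (bigD1_seq n) ?mem_iota ?iota_uniq //.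
  rewrite count_nseq /= eqxx mul1n big1 ?addn0 // => k /negPf neq.
  by rewrite count_nseq /= neq.
exists ms => // n; have [k] := ubnP (N.+1 - n)%N.
elim: k n => // k IHk n ltk; case: (leqP n N) => [lenN|ltNn]; last first.
  by rewrite (weight_mult_large leN) ?d0.
rewrite weight_mult_rec countE // IHk ?subnK //.
by rewrite subSS; apply: leq_ltn_trans (leq_sub2l N (leqnSn n)) _;
  rewrite -ltnS -subSn.
Qed.

Lemma prod_irr_charpoly (A : comNzRingType) (z q : A) ms N :
    all (fun m => m <= N)%N ms ->
  \prod_(m <- ms) irr_charpoly z q m =
  \prod_(n < N.+1) weight_factor z q n ^+ weight_mult ms n.
Proof.
elim: ms => [|m ms IHms] /=; first by rewrite big_nil big1.
case/andP=> lemN /IHms IH; rewrite big_cons IH.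
rewrite /weight_mult /= -/(weight_mult _ _).
under [RHS]eq_bigr => n _ do rewrite exprD.
rewrite [RHS]big_split /=; congr (_ * _).
rewrite /irr_charpoly (big_ord_widen_cond N.+1 (fun n => odd n == odd m)
  (weight_factor z q)) //.
rewrite big_mkcond; apply: eq_bigr => n _.
by rewrite ltnS andbC; case: (_ && _).
Qed.

Lemma prod_weight_factor (A : comNzRingType) (z q : A) (d : nat -> nat) N :
  \prod_(n < N.+1) weight_factor z q n ^+ d n =
  z ^+ d 0%N * \prod_(1 <= n < N.+1) (z ^+ 2 - (n ^ 2)%:R * q) ^+ d n.
Proof.
rewrite -(big_mkord xpredT (fun n => weight_factor z q n ^+ d n)) big_ltn //.
by congr (_ * _); apply: eq_big_nat => -[].
Qed.

End Multiplicities.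

(** * The characterization *)

Theorem corollary4p3 (R : realType) (f : {mpoly R[i][4]}) :
  (exists (V : vectType R[i]) (phi : 'Hom(subvs_of (sl2 R[i]), 'End(V))),
      sl2_representation phi /\ f = sl2_charpoly phi)
  <->
  (exists (N : nat) (d : nat -> nat),
      [/\ forall n : nat, (N < n)%N -> d n = 0%N,
          f = zvar R[i] 0 ^+ d 0%N *
              \prod_(1 <= n < N.+1)
                (zvar R[i] 0 ^+ 2
                 - (n ^ 2)%:R * (zvar R[i] 1 ^+ 2 + zvar R[i] 2 * zvar R[i] 3))
                ^+ d n
        & forall n : nat, (d n.+2 <= d n)%N]).
Proof.
apply: (iff_trans (representation_charpolyP f)).
split=> [[ms ->]|[N [d [d0 -> d_dec]]]].
  have leN : all (fun m => m <= \max_(m <- ms) m)%N ms.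
    by apply/allP => m ms_m; apply: leq_bigmax_seq.
  exists (\max_(m <- ms) m)%N, (weight_mult ms); split.
  - by move=> n; apply: weight_mult_large.
  - by rewrite (prod_irr_charpoly _ _ leN) prod_weight_factor.
  - exact: weight_multS2.
have [ms leN multE] := exists_weights d0 d_dec.
exists ms; rewrite (prod_irr_charpoly _ _ leN) -prod_weight_factor.
by apply: eq_bigr => n _; rewrite multE.
Qed.
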